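(* The Lie algebra of the variational symmetry group of the functional $$\mathcal{L}[\omega]=\int\!\!\int_D\left(-\frac12\omega_u\omega_v-e^{\omega}\right)du\,dv,$$ where $D$ is a domain in $\mathbb{R}^2$ and $\omega\in C^2(D)$, is described (spanned) by the vector fields $$W_1=u\frac{\partial}{\partial u}-\frac{\partial}{\partial\omega},\qquad W_2=v\frac{\partial}{\partial v}-\frac{\partial}{\partial\omega},\qquad W_3=\frac{\partial}{\partial u},\qquad W_4=\frac{\partial}{\partial v}.$$
   Context: For a functional $\int\!\!\int L(u,v,\omega^{(1)})\,du\,dv$ with $\omega^{(1)}=(\omega,\omega_u,\omega_v)$, a variational symmetry group is a local group of transformations of the space of $(u,v,\omega)$ such that, whenever a transformation of the group carries the graph of $\omega=f(u,v)$ over a subdomain to the graph of $\bar\omega=\bar f(\bar u,\bar v)$, the integral of $L$ over the corresponding domains is unchanged. Its Lie algebra consists of the smooth vector fields $X=\zeta(u,v,\omega)\frac{\partial}{\partial u}+\eta(u,v,\omega)\frac{\partial}{\partial v}+\phi(u,v,\omega)\frac{\partial}{\partial\omega}$ satisfying $\mathrm{pr}^{(1)}X(L)+L\,(D_u\zeta+D_v\eta)=0$ identically on the jet space, where $D_u,D_v$ are total derivatives and $\mathrm{pr}^{(1)}X=X+\phi^u\frac{\partial}{\partial\omega_u}+\phi^v\frac{\partial}{\partial\omega_v}$ with $\phi^u=D_u(\phi-\zeta\omega_u-\eta\omega_v)+\zeta\omega_{uu}+\eta\omega_{uv}$, $\phi^v=D_v(\phi-\zeta\omega_u-\eta\omega_v)+\zeta\omega_{uv}+\eta\omega_{vv}$.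 *)

(* Defs.v *)
From HB Require Import structures.
From mathcomp Require Import all_boot all_order all_algebra.
From mathcomp Require Import all_classical all_reals all_analysis.

Set Implicit Arguments.
Unset Strict Implicit.
Unset Printing Implicit Defensive.

Import Order.TTheory GRing.Theory Num.Theory.
Import numFieldNormedType.Exports.

Local Open Scope classical_set_scope.
Local Open Scope ring_scope.

(* Class C^k on an open set A of a finite-dimensional space V; asking for the
   derivatives in all directions v, and not only along a basis, makes the
   definition basis-free without changing its meaning. *)
Fixpoint Ck (R : realType) (V W : normedModType R) (k : nat)
    (A : set V) (f : V -> W) : Prop :=
  (forall x, A x -> {for x, continuous f}) /\
  (if k is k'.+1 then
     forall v : V, (forall x, A x -> derivable f x v) /\ Ck k' A ('D_v f)
   else True).

Definition smooth (R : realType) (V W : normedModType R)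
    (A : set V) (f : V -> W) : Prop :=
  forall k, Ck k A f.

Definition is_domain (T : topologicalType) (D : set T) : Prop :=
  [/\ open D, connected D & D !=set0].

Section Jets.
Variable R : realType.

(* Coordinates: (u, v, w) on jet0, (u, v, w, w_u, w_v) on jet1, and
   (u, v, w, w_u, w_v, w_uu, w_uv, w_vv) on jet2, where w stands for omega. *)
Local Notation jet0 := (R * R * R)%type.
Local Notation jet1 := (R * R * R * R * R)%type.
Local Notation jet2 := (R * R * R * R * R * R * R * R)%type.

Definition jet2_to1 (j : jet2) : jet1 := j.1.1.1.
Definition jet1_to0 (j : jet1) : jet0 := j.1.1.

Definition jet0_over (D : set (R * R)) : set jet0 :=
  [set x | D x.1].
Definition jet2_over (D : set (R * R)) : set jet2 :=
  [set j | D (jet1_to0 (jet2_to1 j)).1].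

Definition d_u (F : jet1 -> R) : jet1 -> R :=
  'D_((1, 0, 0, 0, 0) : jet1) F.
Definition d_v (F : jet1 -> R) : jet1 -> R :=
  'D_((0, 1, 0, 0, 0) : jet1) F.
Definition d_w (F : jet1 -> R) : jet1 -> R :=
  'D_((0, 0, 1, 0, 0) : jet1) F.
Definition d_wu (F : jet1 -> R) : jet1 -> R :=
  'D_((0, 0, 0, 1, 0) : jet1) F.
Definition d_wv (F : jet1 -> R) : jet1 -> R :=
  'D_((0, 0, 0, 0, 1) : jet1) F.

Definition total_u (F : jet1 -> R) (j : jet2) : R :=
  let: (u, v, w, wu, wv, wuu, wuv, wvv) := j in
  let j1 := (u, v, w, wu, wv) in
  d_u F j1 + wu * d_w F j1 + wuu * d_wu F j1 + wuv * d_wv F j1.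

Definition total_v (F : jet1 -> R) (j : jet2) : R :=
  let: (u, v, w, wu, wv, wuu, wuv, wvv) := j in
  let j1 := (u, v, w, wu, wv) in
  d_v F j1 + wv * d_w F j1 + wuv * d_wu F j1 + wvv * d_wv F j1.

(* The vector field zeta d/du + eta d/dv + phi d/dw is represented by the map
   (zeta, eta, phi). *)
Definition vfield : Type := jet0 -> R * R * R.

(* The components, seen as functions on jet1. *)
Definition zeta (X : vfield) (j : jet1) : R := (X (jet1_to0 j)).1.1.
Definition eta (X : vfield) (j : jet1) : R := (X (jet1_to0 j)).1.2.
Definition phi (X : vfield) (j : jet1) : R := (X (jet1_to0 j)).2.

Definition characteristic (X : vfield) (j : jet1) : R :=
  let: (u, v, w, wu, wv) := j in
  phi X j - zeta X j * wu - eta X j * wv.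

Definition phi_u (X : vfield) (j : jet2) : R :=
  let: (u, v, w, wu, wv, wuu, wuv, wvv) := j in
  total_u (characteristic X) j
  + zeta X (jet2_to1 j) * wuu + eta X (jet2_to1 j) * wuv.

Definition phi_v (X : vfield) (j : jet2) : R :=
  let: (u, v, w, wu, wv, wuu, wuv, wvv) := j in
  total_v (characteristic X) j
  + zeta X (jet2_to1 j) * wuv + eta X (jet2_to1 j) * wvv.

(* The second-order coordinates cancel in phi_u and phi_v, but the defining
   formulas involve them, so the prolongation is evaluated on jet2. *)
Definition prolong1 (X : vfield) (L : jet1 -> R) (j : jet2) : R :=
  let j1 := jet2_to1 j in
  zeta X j1 * d_u L j1 + eta X j1 * d_v L j1 + phi X j1 * d_w L j1
  + phi_u X j * d_wu L j1 + phi_v X j * d_wv L j1.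

(* Lie algebra of the variational symmetry group of the functional
   w |-> \iint_D L(u, v, w, w_u, w_v) du dv.  Vector fields live on D x R; the
   values of X outside D x R are unconstrained. *)
Definition variational_symmetry_algebra (D : set (R * R)) (L : jet1 -> R) :
    set vfield :=
  [set X | smooth (jet0_over D) X /\
    forall j, jet2_over D j ->
      prolong1 X L j
      + L (jet2_to1 j) * (total_u (zeta X) j + total_v (eta X) j) = 0].

Definition span_over (D : set (R * R)) (n : nat) (W : n.-tuple vfield) :
    set vfield :=
  [set X | exists a : 'I_n -> R, forall x, jet0_over D x ->
    X x = \sum_(i < n) a i *: tnth W i x].

Definition liouville_lagrangian (j : jet1) : R :=
  let: (u, v, w, wu, wv) := j in - (1 / 2) * wu * wv - expR w.

Definition W1 : vfield := fun '(u, v, w) => (u, 0, -1).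
Definition W2 : vfield := fun '(u, v, w) => (0, v, -1).
Definition W3 : vfield := fun=> (1, 0, 0).
Definition W4 : vfield := fun=> (0, 1, 0).

End Jets.

(* Main.v *)
(* The infinitesimal criterion for L = - w_u w_v / 2 - e^w is a polynomial
   identity in w_u, w_v with coefficients on D x R.  Its coefficients force
   zeta to depend on u only, eta on v only, and phi to be constant, with
   zeta_u + eta_v = - phi.  Separation of variables then makes zeta_u and eta_v
   constant on every box, so the field is there
   (a u + c, b v + d, - (a + b)) = a W1 + b W2 + c W3 + d W4.
   The coefficients are determined by the germ of the field at any point, hence
   are locally constant in the base point, hence constant on the connected D. *)
Require Import Defs.
From mathcomp Require Import all_boot all_order all_algebra.
From mathcomp Require Import ring lra.
From mathcomp Require Import all_classical all_reals all_analysis.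
Import Order.TTheory GRing.Theory Num.Theory.
Import numFieldNormedType.Exports.

Set Implicit Arguments.
Unset Strict Implicit.
Unset Printing Implicit Defensive.

Local Open Scope classical_set_scope.
Local Open Scope ring_scope.

(** * Directional derivatives through restriction to lines *)

Lemma derive_slice (R : numFieldType) (V W : normedModType R) (f : V -> W)
    (x v : V) :
  'D_v f x = 'D_1 (fun h : R => f (h *: v + x)) 0.
Proof.
rewrite /derive; congr (lim (_ @ 0^')); apply/funext => h /=.
by rewrite addr0 scale0r add0r [_ *: 1]mulr1.
Qed.

(** Passage to one real variable: the chain rule, the mean value theorem and local comparison can
    then be applied to the restriction of [f] to a line. *)
Lemma is_derive_slice (R : numFieldType) (V W : normedModType R) (f : V -> W)
    (x v : V) (df : W) :
  is_derive x v f df <-> is_derive (0 : R) 1 (fun h : R => f (h *: v + x)) df.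
Proof.
split=> -[d1 d2]; apply: DeriveDef.
- exact: (derivable1P f x v).1.
- by rewrite -derive_slice.
- exact: (derivable1P f x v).2.
- by rewrite derive_slice.
Qed.

Lemma is_derive_fst (R : numFieldType) (V W1 W2 : normedModType R)
    (f : V -> W1 * W2) (x v : V) (df : W1 * W2) :
  is_derive x v f df -> is_derive x v (fst \o f) df.1.
Proof.
move=> [fxv dfE].
have c : h^-1 *: ((fst \o f) (h *: v + x) - (fst \o f) x) @[h --> 0^'] --> df.1.
  rewrite -dfE; apply: (cvg_comp (fun h : R => h^-1 *: (f (h *: v + x) - f x)) fst fxv).
  exact: cvg_fst.
by apply: DeriveDef; [apply: cvgP c|apply: cvg_lim c].
Qed.

Lemma is_derive_snd (R : numFieldType) (V W1 W2 : normedModType R)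
    (f : V -> W1 * W2) (x v : V) (df : W1 * W2) :
  is_derive x v f df -> is_derive x v (snd \o f) df.2.
Proof.
move=> [fxv dfE].
have c : h^-1 *: ((snd \o f) (h *: v + x) - (snd \o f) x) @[h --> 0^'] --> df.2.
  rewrite -dfE; apply: (cvg_comp (fun h : R => h^-1 *: (f (h *: v + x) - f x)) snd fxv).
  exact: cvg_snd.
by apply: DeriveDef; [apply: cvgP c|apply: cvg_lim c].
Qed.

Lemma is_derive_expR_comp (R : realType) (V : normedModType R) (g : V -> R)
    (x v : V) (dg : R) :
  is_derive x v g dg -> is_derive x v (expR \o g) (expR (g x) * dg).
Proof.
move=> /is_derive_slice dg0; apply/is_derive_slice.
have -> : expR (g x) = expR (g (0 *: v + x)) by rewrite scale0r add0r.
exact: (is_derive1_comp (is_derive_expR _) dg0).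
Qed.

(** Mean value theorem for the restriction of [f] to the segment between 0 and [t], whose derivative
    is [c] throughout. The two signs of [t] give the two orders of the endpoints. *)
Lemma is_derive_linear_along (R : realType) (V : normedModType R) (f : V -> R)
    (x e : V) (c r : R) :
  (forall s : R, `|s| < r -> is_derive (s *: e + x) e f c) ->
  forall t : R, `|t| < r -> f (t *: e + x) = f x + c * t.
Proof.
move=> fc t tr; pose g (s : R) := f (s *: e + x).
have dg (s : R) : `|s| < r -> is_derive s 1 g c.
  move=> /fc /is_derive_slice dfs; apply/is_derive_slice.
  rewrite (_ : (fun h => _) = (fun h : R => f (h *: e + (s *: e + x)))) //.
  by apply/funext => h; rewrite /g addrA -scalerDl [h *: 1]mulr1.
have between (a b s : R) : `|a| < r -> `|b| < r -> a <= s <= b -> `|s| < r.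
  by rewrite !ltr_norml => *; lra.
have cg (a b : R) : `|a| < r -> `|b| < r -> {within `[a, b], continuous g}.
  move=> ar br; apply: derivable_within_continuous => s /[!in_itv] /= sab.
  by apply: ex_derive; apply: dg; exact: between sab.
have ddg (a b s : R) : `|a| < r -> `|b| < r -> s \in `]a, b[ -> is_derive s 1 g c.
  move=> ar br /[!in_itv] /= /andP[/ltW as_ /ltW sb]; apply: dg.
  by apply: (between a b); rewrite ?as_.
have r0 : `|0 : R| < r by rewrite normr0 (le_lt_trans _ tr).
have -> : f x = g 0 by rewrite /g scale0r add0r.
rewrite -[f _]/(g t); have [t0|/ltW t0] := leP 0 t.
- have [s _] := MVT_segment t0 (fun s => @ddg _ _ s r0 tr) (cg _ _ r0 tr).
  by rewrite subr0 => /eqP; rewrite subr_eq addrC => /eqP.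
- have [s _] := MVT_segment t0 (fun s => @ddg _ _ s tr r0) (cg _ _ tr r0).
  by lra.
Qed.

(** Evaluation at eight points with coordinates in {-1, 0, 1} gives a nonsingular linear system for
    the eight coefficients. *)
Lemma bivariate_coef_eq0 (R : realFieldType) (c00 c10 c01 c11 c20 c02 c21 c12 : R) :
  (forall x y, c00 + c10 * x + c01 * y + c11 * x * y + c20 * x ^+ 2
    + c02 * y ^+ 2 + c21 * x ^+ 2 * y + c12 * x * y ^+ 2 = 0) ->
  [/\ c00 = 0, c10 = 0, c01 = 0 & c11 = 0] /\
  [/\ c20 = 0, c02 = 0, c21 = 0 & c12 = 0].
Proof.
move=> P.
have := P 0 0; have := P 1 0; have := P (-1) 0; have := P 0 1.
have := P 0 (-1); have := P 1 1; have := P 1 (-1); have := P (-1) 1.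
by move=> *; split; split; lra.
Qed.

(** The two slices coincide near 0, hence so do their derivatives there. This transports a partial
    derivative between parallel segments on which the function takes the same values. *)
Lemma is_derive_slice_unique (R : numFieldType) (V W : normedModType R)
    (f : V -> W) (x y e : V) (dx dy : W) (r : R) : 0 < r ->
  (forall t : R, `|t| < r -> f (t *: e + x) = f (t *: e + y)) ->
  is_derive x e f dx -> is_derive y e f dy -> dx = dy.
Proof.
move=> r0 fxy /is_derive_slice fx /is_derive_slice [_ <-].
rewrite -(near_eq_derive _ (f := fun t : R => f (t *: e + x))) ?derive_val //.
apply/nbhs_ballP; exists r => // t; rewrite /ball /= sub0r normrN; exact: fxy.
Qed.

(** * Functions of class C^k *)

(** Since [A] is open, equality on [A] is equality near each of its points; it therefore passes to
    all directional derivatives, and induction on [k] applies. *)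
Lemma Ck_ext (R : realType) (V W : normedModType R) (A : set V) (f g : V -> W)
    (k : nat) :
  open A -> (forall x, A x -> f x = g x) -> Ck k A f -> Ck k A g.
Proof.
move=> oA; elim: k f g => [|k IHk] f g fg /= [cf Df];
  have near_fg x : A x -> {near x, f =1 g} by
    [move=> Ax; apply: filterS fg _; exact: open_nbhs_nbhs];
  have cg x : A x -> {for x, continuous g} by
    [move=> Ax; rewrite /prop_for /continuous_at -fg //; apply: cvg_trans (cf x Ax);
     apply: near_eq_cvg; exact: near_fg].
  by split.
split=> // v; have [df Ckf] := Df v; split=> [x Ax|].
  by apply: near_eq_derivable (df x Ax); exact: near_fg.
by apply: IHk Ckf => x Ax; apply: near_eq_derive; exact: near_fg.
Qed.

Lemma Ck_cst (R : realType) (V W : normedModType R) (A : set V) (c : W) (k : nat) :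
  Ck k A (cst c : V -> W).
Proof.
elim: k c => [|k IHk] c; split=> //; try by move=> x _; exact: cst_continuous.
move=> v; split=> [x _|]; first exact: derivable_cst.
by rewrite (_ : 'D_v (cst c) = cst 0) //; apply/funext => x; exact: derive_cst.
Qed.

(** * Derivatives on jet spaces and the infinitesimal criterion *)

Section Jets.
Variable R : realType.
Local Notation jet0 := (R * R * R)%type.
Local Notation jet1 := (R * R * R * R * R)%type.
Local Notation jet2 := (R * R * R * R * R * R * R * R)%type.

(** The combination a W1 + b W2 + c W3 + d W4 in closed form. *)
Definition affine_field (a b c d : R) : vfield R :=
  fun x => (a * x.1.1 + c, b * x.1.2 + d, - (a + b)).

Lemma is_derive_jet1_to0 (W : normedModType R) (f : jet0 -> W) (j e : jet1)
    (df : W) :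
  is_derive (jet1_to0 j) (jet1_to0 e) f df ->
  is_derive j e (fun i => f (jet1_to0 i)) df.
Proof. by move=> /is_derive_slice ?; apply/is_derive_slice. Qed.

Lemma is_derive_characteristic (X : vfield R) (j e : jet1) (dX : R * R * R) :
  is_derive (jet1_to0 j) (jet1_to0 e) X dX ->
  is_derive j e (characteristic X)
    (dX.2 - (dX.1.1 * j.1.2 + zeta X j * e.1.2)
          - (dX.1.2 * j.2 + eta X j * e.2)).
Proof.
move=> /is_derive_jet1_to0 dXj.
(* A pointfree form to which the derivative rules for sums and products apply; [snd \o (fst \o id)]
   reads off w_u and [snd \o id] reads off w_v. *)
have -> : characteristic X =
    phi X - zeta X * (snd \o (fst \o id)) - eta X * (snd \o id).
  by apply/funext => -[[[[u v] w] wu] wv].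
have dz : is_derive j e (zeta X) dX.1.1 by exact: (is_derive_fst (is_derive_fst dXj)).
have de : is_derive j e (eta X) dX.1.2 by exact: (is_derive_snd (is_derive_fst dXj)).
have dp : is_derive j e (phi X) dX.2 by exact: (is_derive_snd dXj).
have d1 : is_derive j e (snd \o (fst \o id)) e.1.2.
  exact: (is_derive_snd (is_derive_fst (is_derive_id _ _))).
have d2 : is_derive j e (snd \o id) e.2 by exact: (is_derive_snd (is_derive_id _ _)).
by apply: is_derive_eq; rewrite /GRing.scale /=; ring.
Qed.

Lemma is_derive_liouville_lagrangian (j e : jet1) :
  is_derive j e (@liouville_lagrangian R)
    (- (1 / 2) * (e.1.2 * j.2 + j.1.2 * e.2) - expR j.1.1.2 * e.1.1.2).
Proof.
have -> : @liouville_lagrangian R =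
    cst (- (1 / 2)) * (snd \o (fst \o id)) * (snd \o id)
    - (expR \o (snd \o (fst \o (fst \o id)))).
  by apply/funext => -[[[[u v] w] wu] wv].
have d1 : is_derive j e (snd \o (fst \o id)) e.1.2.
  exact: (is_derive_snd (is_derive_fst (is_derive_id _ _))).
have d2 : is_derive j e (snd \o id) e.2 by exact: (is_derive_snd (is_derive_id _ _)).
have d3 : is_derive j e (snd \o (fst \o (fst \o id))) e.1.1.2.
  exact: (is_derive_snd (is_derive_fst (is_derive_fst (is_derive_id _ _)))).
have d4 := is_derive_expR_comp d3.
by apply: is_derive_eq; rewrite !fctE /GRing.scale /=; ring.
Qed.

(** The second-order coordinates cancel on expansion. What remains is a polynomial in [wu] and [wv]
    whose coefficients involve only the values and first derivatives of [X] at [x]. *)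
Lemma liouville_infinitesimal_criterion (X : vfield R) (j : jet2)
    (Xu Xv Xw : R * R * R) (x := jet1_to0 (jet2_to1 j)) :
  is_derive x (1, 0, 0) X Xu -> is_derive x (0, 1, 0) X Xv ->
  is_derive x (0, 0, 1) X Xw ->
  let wu := (jet2_to1 j).1.2 in let wv := (jet2_to1 j).2 in
  prolong1 X (@liouville_lagrangian R) j
  + liouville_lagrangian (jet2_to1 j) * (total_u (zeta X) j + total_v (eta X) j)
  = - expR x.2 * ((X x).2 + Xu.1.1 + Xv.1.2)
    - (Xv.2 / 2 + expR x.2 * Xw.1.1) * wu
    - (Xu.2 / 2 + expR x.2 * Xw.1.2) * wv
    - Xw.2 * wu * wv
    + Xv.1.1 / 2 * wu ^+ 2 + Xu.1.2 / 2 * wv ^+ 2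
    + Xw.1.1 / 2 * wu ^+ 2 * wv + Xw.1.2 / 2 * wu * wv ^+ 2.
Proof.
rewrite {}/x; case: j => [[[[[[[u v] w] wu] wv] wuu] wuv] wvv] /= dXu dXv dXw.
pose j1 : jet1 := (u, v, w, wu, wv).
(* The directions [ewu] and [ewv] project to 0 in jet0, so the components of [X] have zero
   derivative along them. *)
have dX0 : is_derive (u, v, w) (0 : jet0) X 0 by exact: is_derive0.
pose eu : jet1 := (1, 0, 0, 0, 0); pose ev : jet1 := (0, 1, 0, 0, 0).
pose ew : jet1 := (0, 0, 1, 0, 0); pose ewu : jet1 := (0, 0, 0, 1, 0).
pose ewv : jet1 := (0, 0, 0, 0, 1).
have Xj (e : jet1) d (de : is_derive (u, v, w) (jet1_to0 e) X d) :
    [/\ 'D_e (zeta X) j1 = d.1.1, 'D_e (eta X) j1 = d.1.2 &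
    'D_e (characteristic X) j1 = d.2 - (d.1.1 * wu + zeta X j1 * e.1.2)
          - (d.1.2 * wv + eta X j1 * e.2)].
  have dXj := is_derive_jet1_to0 (j := j1) de; split.
  - by apply: derive_val; exact: (is_derive_fst (is_derive_fst dXj)).
  - by apply: derive_val; exact: (is_derive_snd (is_derive_fst dXj)).
  - by apply: derive_val; exact: (@is_derive_characteristic X j1).
rewrite /prolong1 /phi_u /phi_v /total_u /total_v /jet2_to1 /=.
rewrite /d_u /d_v /d_w /d_wu /d_wv.
rewrite (@derive_val _ _ _ _ _ _ _ (is_derive_liouville_lagrangian j1 eu)).
rewrite (@derive_val _ _ _ _ _ _ _ (is_derive_liouville_lagrangian j1 ev)).
rewrite (@derive_val _ _ _ _ _ _ _ (is_derive_liouville_lagrangian j1 ew)).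
rewrite (@derive_val _ _ _ _ _ _ _ (is_derive_liouville_lagrangian j1 ewu)).
rewrite (@derive_val _ _ _ _ _ _ _ (is_derive_liouville_lagrangian j1 ewv)) /=.
have [zu eu' cu] := Xj eu _ dXu.
have [zv ev' cv] := Xj ev _ dXv.
have [zw ew' cw] := Xj ew _ dXw.
have [zwu ewu' cwu] := Xj ewu _ dX0.
have [zwv ewv' cwv] := Xj ewv _ dX0.
rewrite zu zw zwu zwv ev' ew' ewu' ewv' cu cv cw cwu cwv.
by rewrite /zeta /eta /phi /jet1_to0 /=; field.
Qed.

(** * The determining equations *)

(** All coefficients of the criterion vanish, as it holds for every w_u and w_v over a fixed base
    point. Here [a] is zeta_u and [b] is eta_v. *)
Lemma determining_equations (D : set (R * R)) (X : vfield R) (x : jet0) :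
  variational_symmetry_algebra D (@liouville_lagrangian R) X -> D x.1 ->
  exists a b, [/\ is_derive x (1, 0, 0) X (a, 0, 0),
    is_derive x (0, 1, 0) X (0, b, 0), is_derive x (0, 0, 1) X (0, 0, 0)
    & (X x).2 = - (a + b)].
Proof.
move=> [sX eqX] Dx; case: x Dx => [[u v] w] Dx.
have dX e : is_derive ((u, v, w) : jet0) e X ('D_e X (u, v, w)).
  by apply: derivableP; exact: ((sX 1%N).2 e).1.
(* The prefixes [a], [b], [c] mark derivatives in u, v, w; the suffixes [u], [v], [p] mark the
   components zeta, eta, phi. *)
have [[[au av] ap] dXu] : exists d : R * R * R, is_derive ((u, v, w) : jet0) (1, 0, 0) X d.
  by exists ('D_(1, 0, 0) X (u, v, w)); exact: dX.
have [[[bu bv] bp] dXv] : exists d : R * R * R, is_derive ((u, v, w) : jet0) (0, 1, 0) X d.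
  by exists ('D_(0, 1, 0) X (u, v, w)); exact: dX.
have [[[cu cv] cp] dXw] : exists d : R * R * R, is_derive ((u, v, w) : jet0) (0, 0, 1) X d.
  by exists ('D_(0, 0, 1) X (u, v, w)); exact: dX.
have e0 : expR w != 0 by rewrite gt_eqF ?expR_gt0.
have := @bivariate_coef_eq0 R (- expR w * ((X (u, v, w)).2 + au + bv))
  (- (bp / 2 + expR w * cu)) (- (ap / 2 + expR w * cv)) (- cp)
  (bu / 2) (av / 2) (cu / 2) (cv / 2).
case=> [wu wv|].
  (* Second-order coordinates cancel, so they may be set to 0. *)
  have := eqX (u, v, w, wu, wv, 0, 0, 0) Dx.
  rewrite (@liouville_infinitesimal_criterion X (u, v, w, wu, wv, 0, 0, 0)
    _ _ _ dXu dXv dXw) /= => <-.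
  by ring.
move=> [/eqP h00 h10 h01 h11] [h20 h02 h21 h12].
(* The cubic coefficients give zeta_w = eta_w = 0 first; this removes the exponential terms from the
   coefficients of w_u and w_v, which then give phi_v = phi_u = 0. *)
have cu0 : cu = 0 by lra.
have cv0 : cv = 0 by lra.
move: h10 h01; rewrite cu0 cv0 mulr0 => h10 h01.
have bu0 : bu = 0 by lra.
have av0 : av = 0 by lra.
have cp0 : cp = 0 by lra.
have ap0 : ap = 0 by lra.
have bp0 : bp = 0 by lra.
move: h00; rewrite mulf_eq0 oppr_eq0 (negPf e0) /= => /eqP h00.
subst; exists au, bv; split => //; lra.
Qed.

(** * The form of a symmetry on a box *)

Lemma jet0_shift_u (t u v w : R) :
  t *: ((1, 0, 0) : jet0) + (u, v, w) = (t + u, v, w).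
Proof. by congr (_, _, _); rewrite /= /GRing.scale /= ?mulr1 ?mulr0 ?add0r. Qed.

Lemma jet0_shift_v (t u v w : R) :
  t *: ((0, 1, 0) : jet0) + (u, v, w) = (u, t + v, w).
Proof. by congr (_, _, _); rewrite /= /GRing.scale /= ?mulr1 ?mulr0 ?add0r. Qed.

Lemma jet0_shift_w (t u v w : R) :
  t *: ((0, 0, 1) : jet0) + (u, v, w) = (u, v, t + w).
Proof. by congr (_, _, _); rewrite /= /GRing.scale /= ?mulr1 ?mulr0 ?add0r. Qed.

Lemma symmetry_locally_affine (D : set (R * R)) (X : vfield R) (p : R * R) :
  open D -> variational_symmetry_algebra D (@liouville_lagrangian R) X -> D p ->
  exists a b c d, \forall q \near p, forall w, X (q, w) = affine_field a b c d (q, w).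
Proof.
move=> oD sX; case: p => u0 v0 Dp.
have /nbhs_ballP[r /= r0 rD] : nbhs (u0, v0) D by exact: open_nbhs_nbhs.
(* Balls of the product are boxes, so axis-parallel segments between their points remain in [D]. *)
have boxD s t : `|s| < r -> `|t| < r -> D (s + u0, t + v0).
  move=> sr tr; apply: rD; split; rewrite /ball /= opprD addrCA subrr addr0 normrN //.
have DE s t w : `|s| < r -> `|t| < r -> exists a b,
    [/\ is_derive ((s + u0, t + v0, w) : jet0) (1, 0, 0) X (a, 0, 0),
    is_derive ((s + u0, t + v0, w) : jet0) (0, 1, 0) X (0, b, 0),
    is_derive ((s + u0, t + v0, w) : jet0) (0, 0, 1) X (0, 0, 0)
    & (X (s + u0, t + v0, w)).2 = - (a + b)].
  by move=> sr tr; apply: (determining_equations sX); exact: boxD.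
(* These are zeta, eta and phi. *)
pose z x := (X x).1.1; pose h x := (X x).1.2; pose f x := (X x).2.
have dz x e dX : is_derive x e X dX -> is_derive x e z dX.1.1.
  by move=> dX'; exact: (is_derive_fst (is_derive_fst dX')).
have dh x e dX : is_derive x e X dX -> is_derive x e h dX.1.2.
  by move=> dX'; exact: (is_derive_snd (is_derive_fst dX')).
have df x e dX : is_derive x e X dX -> is_derive x e f dX.2.
  by move=> dX'; exact: (is_derive_snd dX').
have along_w (F : jet0 -> R) :
    (forall s t w, `|s| < r -> `|t| < r ->
      is_derive ((s + u0, t + v0, w) : jet0) (0, 0, 1) F 0) ->
    forall s t w, `|s| < r -> `|t| < r ->
      F (s + u0, t + v0, w) = F (s + u0, t + v0, 0).
  move=> dF s t w sr tr.
  (* The fibre in w is the whole line, so any radius exceeding the absolute value of [w] is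
     admissible. *)
  have := @is_derive_linear_along R _ F (s + u0, t + v0, 0) (0, 0, 1) 0 (`|w| + 1).
  move=> /(_ _ w); rewrite jet0_shift_w addr0 mul0r addr0; apply.
  - by move=> y _; rewrite jet0_shift_w; exact: dF.
  - by rewrite ltrDl.
have along_u (F : jet0 -> R) c t : `|t| < r ->
    (forall s, `|s| < r -> is_derive ((s + u0, t + v0, 0) : jet0) (1, 0, 0) F c) ->
    forall s, `|s| < r -> F (s + u0, t + v0, 0) = F (u0, t + v0, 0) + c * s.
  move=> tr dF s sr.
  have := @is_derive_linear_along R _ F (u0, t + v0, 0) (1, 0, 0) c r.
  move=> /(_ _ s); rewrite jet0_shift_u; apply => // y yr.
  by rewrite jet0_shift_u; exact: dF.
have along_v (F : jet0 -> R) c s : `|s| < r ->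
    (forall t, `|t| < r -> is_derive ((s + u0, t + v0, 0) : jet0) (0, 1, 0) F c) ->
    forall t, `|t| < r -> F (s + u0, t + v0, 0) = F (s + u0, v0, 0) + c * t.
  move=> sr dF t tr.
  have := @is_derive_linear_along R _ F (s + u0, v0, 0) (0, 1, 0) c r.
  move=> /(_ _ t); rewrite jet0_shift_v; apply => // y yr.
  by rewrite jet0_shift_v; exact: dF.
have r00 : `|0 : R| < r by rewrite normr0.
have zv s t w : `|s| < r -> `|t| < r ->
    is_derive ((s + u0, t + v0, w) : jet0) (0, 1, 0) z 0.
  by move=> sr tr; have [a [b [_ /dz]]] := DE s t w sr tr.
have zw s t w : `|s| < r -> `|t| < r ->
    is_derive ((s + u0, t + v0, w) : jet0) (0, 0, 1) z 0.
  by move=> sr tr; have [a [b [_ _ /dz]]] := DE s t w sr tr.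
have hu s t w : `|s| < r -> `|t| < r ->
    is_derive ((s + u0, t + v0, w) : jet0) (1, 0, 0) h 0.
  by move=> sr tr; have [a [b [/dh]]] := DE s t w sr tr.
have hw s t w : `|s| < r -> `|t| < r ->
    is_derive ((s + u0, t + v0, w) : jet0) (0, 0, 1) h 0.
  by move=> sr tr; have [a [b [_ _ /dh]]] := DE s t w sr tr.
have fu s t w : `|s| < r -> `|t| < r ->
    is_derive ((s + u0, t + v0, w) : jet0) (1, 0, 0) f 0.
  by move=> sr tr; have [a [b [/df]]] := DE s t w sr tr.
have fv s t w : `|s| < r -> `|t| < r ->
    is_derive ((s + u0, t + v0, w) : jet0) (0, 1, 0) f 0.
  by move=> sr tr; have [a [b [_ /df]]] := DE s t w sr tr.
have fw s t w : `|s| < r -> `|t| < r ->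
    is_derive ((s + u0, t + v0, w) : jet0) (0, 0, 1) f 0.
  by move=> sr tr; have [a [b [_ _ /df]]] := DE s t w sr tr.
have zE s t w : `|s| < r -> `|t| < r -> z (s + u0, t + v0, w) = z (s + u0, v0, 0).
  move=> sr tr; rewrite (along_w z zw) //.
  by rewrite (along_v z 0 s sr (fun t tr => zv s t 0 sr tr)) // mul0r addr0.
have hE s t w : `|s| < r -> `|t| < r -> h (s + u0, t + v0, w) = h (u0, t + v0, 0).
  move=> sr tr; rewrite (along_w h hw) //.
  by rewrite (along_u h 0 t tr (fun s sr => hu s t 0 sr tr)) // mul0r addr0.
have fE s t w : `|s| < r -> `|t| < r -> f (s + u0, t + v0, w) = f (u0, v0, 0).
  move=> sr tr; rewrite (along_w f fw) //.
  rewrite (along_u f 0 t tr (fun s sr => fu s t 0 sr tr)) // mul0r addr0.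
  have := along_v f 0 0 r00 (fun t tr => fv 0 t 0 r00 tr) t tr.
  by rewrite mul0r addr0 add0r.
(* The coefficients [a] and [b] are zeta_u and eta_v at the centre of the box. *)
have [a [b [/dz /= za /dh /= hb _ ab]]] := DE 0 0 0 r00 r00.
have zs s : `|s| < r -> z (s + u0, v0, 0) = z (u0, v0, 0) + a * s.
  have := @along_u z a 0 r00; rewrite add0r; apply => {}s sr.
  have [a' [b' [/dz /= za' /dh /= hb' _ ab']]] := DE s 0 0 sr r00.
  move: za hb ab za' hb' ab'; rewrite !add0r => za hb ab za' hb' ab'.
  (* eta does not depend on u, hence neither does eta_v: no symmetry of the
     mixed partial derivatives is needed. *)
  have bb : b = b'.
    apply: is_derive_slice_unique r0 _ hb hb' => t tr.
    by rewrite !jet0_shift_v hE.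
  have := fE s 0 0 sr r00; rewrite add0r /f ab ab' -bb => aa.
  by have <- : a' = a by lra.
have ht t : `|t| < r -> h (u0, t + v0, 0) = h (u0, v0, 0) + b * t.
  have := @along_v h b 0 r00; rewrite add0r; apply => {}t tr.
  have [a' [b' [/dz /= za' /dh /= hb' _ ab']]] := DE 0 t 0 r00 tr.
  move: za hb ab za' hb' ab'; rewrite !add0r => za hb ab za' hb' ab'.
  (* Symmetrically, zeta does not depend on v, hence neither does zeta_u; constancy of phi = -
     (zeta_u + eta_v) then fixes eta_v. *)
  have aa : a = a'.
    apply: is_derive_slice_unique r0 _ za za' => s sr.
    by rewrite !jet0_shift_u zE.
  have := fE 0 t 0 r00 tr; rewrite add0r /f ab ab' -aa => bb.
  by have <- : b' = b by lra.
(* The constant terms convert offsets from the centre of the box into absolute coordinates. *)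
exists a, b, (z (u0, v0, 0) - a * u0), (h (u0, v0, 0) - b * v0).
apply/nbhs_ballP; exists r => // -[u v] [/= ur vr] w.
have [s [t [sr tr -> ->]]] : exists s t, [/\ `|s| < r, `|t| < r, u = s + u0 & v = t + v0].
  exists (u - u0), (v - v0); split; rewrite ?subrK // distrC //.
rewrite [X _]surjective_pairing [(X _).1]surjective_pairing.
rewrite -/(z _) -/(h _) -/(f _) zE // hE // fE // zs // ht //.
move: ab; rewrite !add0r /affine_field /= /f => ->.
by congr (_, _, _); ring.
Qed.

(** * From local to global coefficients *)

(** Comparing the centre with its shifts by r / 2 in u and in v determines the slopes [a] and [b];
    the value at the centre then determines [c] and [d]. *)
Lemma affine_field_unique (p : R * R) (a b c d a' b' c' d' : R) :
  (\forall q \near p, forall w,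
    affine_field a b c d (q, w) = affine_field a' b' c' d' (q, w)) ->
  [/\ a = a', b = b', c = c' & d = d'].
Proof.
move=> /nbhs_ballP[r /= r0 E]; case: p E => u v E.
have r2 : `|r / 2| < r by rewrite gtr0_norm; lra.
have B s t : `|s| < r -> `|t| < r -> ball (u, v) r (u + s, v + t).
  by move=> sr tr; split; rewrite /ball /= opprD addNKr normrN.
have r00 : `|0 : R| < r by rewrite normr0.
have [e1 e2 e3] := E _ (B 0 0 r00 r00) 0.
have [e4 _ _] := E _ (B (r / 2) 0 r2 r00) 0.
have [_ e5 _] := E _ (B 0 (r / 2) r00 r2) 0.
have aa : a = a'.
  have : (a - a') * (r / 2) = 0 by move: e1 e4; rewrite /= => *; lra.
  by move=> /eqP; rewrite mulf_eq0 => /orP[/eqP|/eqP]; lra.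
have bb : b = b'.
  have : (b - b') * (r / 2) = 0 by move: e2 e5; rewrite /= => *; lra.
  by move=> /eqP; rewrite mulf_eq0 => /orP[/eqP|/eqP]; lra.
by subst; split => //; move: e1 e2 => /=; lra.
Qed.

Lemma symmetry_affine (D : set (R * R)) (X : vfield R) : is_domain D ->
  variational_symmetry_algebra D (@liouville_lagrangian R) X ->
  exists a b c d, forall x, D x.1 -> X x = affine_field a b c d x.
Proof.
move=> [oD cD [p0 Dp0]] sX.
have loc p := @symmetry_locally_affine D X p oD sX.
have [a [b [c [d p0E]]]] := loc _ Dp0.
(* Requiring agreement near the point, not only at it, makes each such set open. *)
pose good a b c d := [set p : R * R | \forall q \near p, forall w,
  X (q, w) = affine_field a b c d (q, w)].
have ogood a1 b1 c1 d1 : open (good a1 b1 c1 d1).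
  by rewrite openE => p /nbhs_interior.
pose G := good a b c d.
pose B := [set p : R * R | exists a1 b1 c1 d1,
   ~ [/\ a = a1, b = b1, c = c1 & d = d1] /\ good a1 b1 c1 d1 p].
have oB : open B.
  rewrite openE => p [a1 [b1 [c1 [d1 [ne gp]]]]].
  have := @open_nbhs_nbhs _ p _ (conj (ogood a1 b1 c1 d1) gp).
  by apply: filterS => q gq; exists a1, b1, c1, d1.
have GB p : G p -> ~ B p.
  (* Near a common point of [G] and [B] two affine fields with distinct coefficients would both
     equal [X]. *)
  move=> Gp [a1 [b1 [c1 [d1 [+ gp]]]]]; apply.
  apply: (@affine_field_unique p); near=> q => w.
  by rewrite -(near Gp q) // -(near gp q).
(* The open sets [G] and [B] are disjoint on [D] and cover it, so the trace of [G] is also that of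
   the closed complement of [B]; it is nonempty and [D] is connected. *)
have DG : D `&` G = D.
  apply: cD; first by exists p0.
  - by exists G; [exact: ogood|].
  - exists (~` B); first exact: open_closedC.
    apply/seteqP; split => p [Dp Hp]; split => //; first exact: GB.
    have [a1 [b1 [c1 [d1 gp]]]] := loc _ Dp.
    have [[? ? ? ?]|ne] := pselect [/\ a = a1, b = b1, c = c1 & d = d1].
      by subst.
    by case: Hp; exists a1, b1, c1, d1.
exists a, b, c, d => -[p w] /= Dp.
have [_ Gp] : (D `&` G) p by rewrite DG.
by move: Gp => /nbhs_singleton/(_ w).
Unshelve. all: by end_near. Qed.

(** * Affine fields are symmetries *)

Lemma is_derive_affine_field (a b c d : R) (x v : jet0) :
  is_derive x v (affine_field a b c d) (a * v.1.1, b * v.1.2, 0).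
Proof.
have D : h^-1 *: (affine_field a b c d (h *: v + x) - affine_field a b c d x)
    @[h --> 0^'] --> ((a * v.1.1, b * v.1.2, 0) : R * R * R).
  (* The difference quotient of an affine map is constant for nonzero [h]. *)
  apply: cvg_near_cst; near=> h.
  have h0 : h != 0 by near: h; exact: nbhs_dnbhs_neq.
  by congr (_, _, _); rewrite /affine_field /= /GRing.scale /=; field.
by apply: DeriveDef; [apply: cvgP D|apply: cvg_lim D].
Unshelve. all: by end_near. Qed.

(** Each directional derivative is constant in the base point, so beyond continuity and one
    differentiation only constant maps occur. *)
Lemma affine_field_smooth (a b c d : R) (A : set jet0) :
  smooth A (affine_field a b c d).
Proof.
have cont x : {for x, continuous (affine_field a b c d)}.
  have c1 : {for x, continuous (fun y : jet0 => y.1.1)}.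
    exact: (@continuous_comp _ _ _ fst fst x cvg_fst cvg_fst).
  have c2 : {for x, continuous (fun y : jet0 => y.1.2)}.
    exact: (@continuous_comp _ _ _ fst snd x cvg_fst cvg_snd).
  have zc : {for x, continuous (fun y : jet0 => a * y.1.1 + c)}.
    by apply: cvgD; [apply: cvgM => //|]; exact: cvg_cst.
  have hc : {for x, continuous (fun y : jet0 => b * y.1.2 + d)}.
    by apply: cvgD; [apply: cvgM => //|]; exact: cvg_cst.
  have pc : {for x, continuous (fun _ : jet0 => - (a + b))} by exact: cvg_cst.
  exact: (cvg_pair (cvg_pair zc hc) pc).
case=> [|k]; split=> // v; split=> [x _|].
  by have [] := is_derive_affine_field a b c d x v.
rewrite (_ : 'D_v _ = cst (a * v.1.1, b * v.1.2, 0)); first exact: Ck_cst.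
by apply/funext => x; have [] := is_derive_affine_field a b c d x v.
Qed.

(** Every term of the criterion vanishes, the constant one because phi + zeta_u + eta_v = - (a + b)
    + a + b. As [D] is open, agreement over [D] suffices to compute the derivatives of [X] there. *)
Lemma affine_symmetry (D : set (R * R)) (X : vfield R) (a b c d : R) :
  open D -> (forall x, jet0_over D x -> X x = affine_field a b c d x) ->
  variational_symmetry_algebra D (@liouville_lagrangian R) X.
Proof.
move=> oD XE.
have oD0 : open (jet0_over D).
  by apply: (@open_comp _ _ fst) oD => x _; exact: cvg_fst.
split=> [k|j Dj].
  apply: Ck_ext oD0 _ (@affine_field_smooth a b c d _ k) => x Dx.
  by rewrite XE.
have dX e : is_derive (jet1_to0 (jet2_to1 j)) e X (a * e.1.1, b * e.1.2, 0).
  apply: near_eq_is_derive (is_derive_affine_field a b c d _ e).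
  apply: filterS (open_nbhs_nbhs (conj oD0 Dj)) => x Dx.
  by rewrite XE.
rewrite (liouville_infinitesimal_criterion (dX _) (dX _) (dX _)) XE //=.
by ring.
Qed.

Lemma affine_field_span (s : 'I_4 -> R) (x : jet0) :
  \sum_(i < 4) s i *: tnth [tuple @W1 R; @W2 R; @W3 R; @W4 R] i x =
  affine_field (s 0) (s 1) (s 2) (s 3) x.
Proof.
case: x => [[u v] w]; rewrite !big_ord_recl big_ord0 !(tnth_nth (@W1 R)) /=.
rewrite /W1 /W2 /W3 /W4 /affine_field /=.
(* The indices produced by unfolding the sum are identified with the numerals of ['I_4]. *)
have -> : lift ord0 ord0 = 1 :> 'I_4 by exact: val_inj.
have -> : lift ord0 (lift ord0 ord0) = 2 :> 'I_4 by exact: val_inj.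
have -> : lift ord0 (lift ord0 (lift ord0 ord0)) = 3 :> 'I_4 by exact: val_inj.
by congr (_, _, _); rewrite /= /GRing.scale /=; ring.
Qed.
End Jets.

(** * The two inclusions between symmetry algebra and span *)

Theorem theorem16 (R : realType) (D : set (R * R)) (hD : is_domain D) :
  variational_symmetry_algebra D (@liouville_lagrangian R) =
  span_over D [tuple @W1 R; @W2 R; @W3 R; @W4 R].
Proof.
apply/seteqP; split => X.
- move=> /(symmetry_affine hD) [a [b [c [d XE]]]].
  exists (fun i => nth 0 [:: a; b; c; d] i) => x Dx.
  by rewrite affine_field_span XE.
- move=> [s XE]; have [oD _ _] := hD.
  apply: (@affine_symmetry R D X (s 0) (s 1) (s 2) (s 3)) => // x Dx.
  by rewrite XE // affine_field_span.
Qed.
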